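(* Let $R$ be a commutative Noetherian ring, $I,J$ ideals of $R$, $t\ge 0$ an integer, $M$ an $R$-module, $\mathcal S$ an arbitrary Serre subcategory of the category $\mathrm{Mod}(R)$ of $R$-modules, and $\mathfrak a\in\tilde W(I,J)$. Let $G:\mathrm{Mod}(R)\to\mathrm{Mod}(R)$ be a left exact covariant functor such that $(0:_X\mathfrak a)=(0:_{G(X)}\mathfrak a)$ for any $R$-module $X$, and such that $G(E)$ is an injective $R$-module for any injective $R$-module $E$. Let $G^j$ denote the $j$-th right derived functor of $G$, and consider the natural homomorphism $$\psi:\operatorname{Ext}^t_R(R/\mathfrak a,M)\longrightarrow \operatorname{Hom}_R(R/\mathfrak a,G^t(M)).$$ Then: (i) If $\operatorname{Ext}^{t-j}_R(R/\mathfrak a,G^j(M))\in\mathcal S$ for all $j<t$, then $\operatorname{Ker}\psi\in\mathcal S$. (ii) If $\operatorname{Ext}^{t+1-j}_R(R/\mathfrak a,G^j(M))\in\mathcal S$ for all $j<t$, then $\operatorname{Coker}\psi\in\mathcal S$. (iii) If $\operatorname{Ext}^{n-j}_R(R/\mathfrak a,G^j(M))\in\mathcal S$ for $n=t,t+1$ and all $j<t$, then $\operatorname{Ker}\psi$ and $\operatorname{Coker}\psi$ both belong to $\mathcal S$. Thus $\operatorname{Ext}^t_R(R/\mathfrak a,M)\in\mathcal S$ if and only if $\operatorname{Hom}_R(R/\mathfrak a,G^t(M))\in\mathcal S$.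
   Context: For ideals $I,J$ of $R$, $\tilde W(I,J)$ denotes the set of ideals $\mathfrak a$ of $R$ such that $I^n\subseteq \mathfrak a+J$ for some integer $n\ge 1$. For an $R$-module $X$, $(0:_X\mathfrak a)=\{x\in X:\mathfrak a x=0\}$, which is identified with $\operatorname{Hom}_R(R/\mathfrak a,X)$. A Serre subcategory of $R$-modules is a class of $R$-modules closed under taking submodules, quotients and extensions. Write $F(-)=\operatorname{Hom}_R(R/\mathfrak a,-)$, so that the hypothesis on $G$ reads $FG(X)=F(X)$ for any $R$-module $X$. The natural homomorphism $\psi$ is the canonical (edge) map from the $t$-th right derived functor of the composite $FG$ at $M$ to $F(G^t(M))$, the source being written as $\operatorname{Ext}^t_R(R/\mathfrak a,M)$ on account of $FG(X)=F(X)$. *)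

(* Defs.v *)
From HB Require Import structures.
From mathcomp Require Import all_boot all_order all_algebra.
From mathcomp Require Import boolp classical_sets functions.
Set Implicit Arguments. Unset Strict Implicit. Unset Printing Implicit Defensive.
Import Order.TTheory GRing.Theory Num.Theory.
Local Open Scope ring_scope.
Local Open Scope quotient_scope.

Section LinearMaps.
Variables (R : pzRingType) (U V : lmodType R).

Definition mklin (f : U -> V) (fL : linear f) : {linear U -> V} :=
  HB.pack f (GRing.isLinear.Build R U V *:%R f fL).

Lemma linear_ext (f g : {linear U -> V}) : f =1 g -> f = g.
Proof.
case: f g => f [[f1] [f2]] [g [[g1] [g2]]] /= /funext fg.
subst g; by rewrite (Prop_irrelevance f1 g1) (Prop_irrelevance f2 g2).
Qed.

End LinearMaps.

Section Submodules.
Variables (R : pzRingType) (U : lmodType R).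

Section Mksub.
Variables (P : U -> Prop) (P0 : P 0).
Hypothesis PL : forall a x y, P x -> P y -> P (a *: x + y).

Let S : {pred U} := fun x => `[< P x >].

Let SL : GRing.subsemimod_closed S.
Proof.
apply: GRing.submod_closed_semi.
split=> [|a x y /asboolP Px /asboolP Py]; apply/asboolP; [exact: P0|exact: PL].
Qed.

Definition mksub : submodClosed U := HB.pack S
  (GRing.isSubmodClosed.Build R U S SL).

Lemma mksubP x : reflect (P x) (x \in mksub).
Proof. exact: asboolP. Qed.

End Mksub.

Section Submodule.
Variable N : submodClosed U.

Record submodule := SubModule { smval : U; smvalP : smval \in N }.
HB.instance Definition _ := [isSub for smval].
HB.instance Definition _ := [Choice of submodule by <:].
HB.instance Definition _ := [SubChoice_isSubLmodule of submodule by <:].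

(* ring_quotient.Quotient.quot needs a zmodClosed predicate, which a
   submodClosed is not canonically. *)
Definition subz : {pred U} := fun x => x \in N.
Fact subz_closed : zmod_closed subz.
Proof. exact: GRing.submod_closedB (submodClosedP N). Qed.
HB.instance Definition _ := GRing.isZmodClosed.Build U subz subz_closed.

Definition quotmod := Quotient.quot subz.
HB.instance Definition _ := GRing.Zmodule.on quotmod.
HB.instance Definition _ := EqQuotient.on quotmod.

Lemma quotmod_eqP (x y : U) :
  reflect (\pi_quotmod x = \pi_quotmod y) (x - y \in N).
Proof. by have := @Quotient.idealrBE U subz x y => /= ->; apply: eqP. Qed.

Lemma quot_piD (x y : U) : \pi_quotmod (x + y) = \pi_quotmod x + \pi_quotmod y.
Proof. exact: (@Quotient.pi_add U subz). Qed.

Lemma repr_modP (x : U) : repr (\pi_quotmod x) - x \in N.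
Proof. by apply/quotmod_eqP; rewrite reprK. Qed.

Definition scaleq (a : R) (x : quotmod) : quotmod := \pi_quotmod (a *: repr x).

Lemma scaleqE a x : scaleq a (\pi_quotmod x) = \pi_quotmod (a *: x).
Proof. by apply/quotmod_eqP; rewrite -scalerBr rpredZ// repr_modP. Qed.

Lemma quot_piP (x : quotmod) : exists u, x = \pi_quotmod u.
Proof. by exists (repr x); rewrite reprK. Qed.

Let scaleqA a b x : scaleq a (scaleq b x) = scaleq (a * b) x.
Proof. by have [u ->] := quot_piP x; rewrite 3!scaleqE scalerA. Qed.
Let scaleq1 : left_id 1 scaleq.
Proof. by move=> x; have [u ->] := quot_piP x; rewrite scaleqE scale1r. Qed.
Let scaleqDr : right_distributive scaleq +%R.
Proof.
move=> a x y; have [u ->] := quot_piP x; have [v ->] := quot_piP y.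
by rewrite -quot_piD 3!scaleqE scalerDr quot_piD.
Qed.
Let scaleqDl x : {morph scaleq^~ x : a b / a + b}.
Proof.
by move=> a b /=; have [u ->] := quot_piP x; rewrite 3!scaleqE scalerDl quot_piD.
Qed.

HB.instance Definition _ := GRing.Zmodule_isLmodule.Build R quotmod
  scaleqA scaleq1 scaleqDr scaleqDl.

Lemma quot_piL : linear (\pi_quotmod : U -> quotmod).
Proof. by move=> a x y; rewrite quot_piD -scaleqE. Qed.

Definition quot_proj : {linear U -> quotmod} := mklin quot_piL.

Lemma proj_eq0 (x : U) : (quot_proj x = 0) <-> (x \in N).
Proof.
rewrite -(linear0 quot_proj); split.
  by move=> /quotmod_eqP; rewrite subr0.
by move=> Nx; apply/quotmod_eqP; rewrite subr0.
Qed.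

Lemma proj_surj (y : quotmod) : exists x, quot_proj x = y.
Proof. by exists (repr y); rewrite /= reprK. Qed.

Lemma smval_linear : linear smval.
Proof. exact: linearP (\val : {linear submodule -> U}). Qed.
Definition sub_incl : {linear submodule -> U} := mklin smval_linear.

End Submodule.
End Submodules.

Section Universal.
Variables (R : pzRingType) (U V W : lmodType R).

Section Lift.
Variables (N : submodClosed U) (f : {linear U -> V}).
Hypothesis fN : forall x, x \in N -> f x = 0.

Let lift (y : quotmod N) : V := f (repr y).

Let liftE x : lift (quot_proj N x) = f x.
Proof.
by apply/eqP; rewrite -subr_eq0 -linearB fN//; exact: repr_modP.
Qed.

Let lift_linear : linear lift.
Proof.
move=> a y z; have [u <-] := proj_surj y; have [v <-] := proj_surj z.
by rewrite -linearP !liftE linearP.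
Qed.

Definition quot_lift : {linear quotmod N -> V} := mklin lift_linear.

Lemma quot_liftE x : quot_lift (quot_proj N x) = f x.
Proof. exact: liftE. Qed.

End Lift.

Section Corestr.
Variables (N : submodClosed V) (f : {linear U -> V}).
Hypothesis fN : forall x, f x \in N.

Let corestr (x : U) : submodule N := SubModule (fN x).

Let corestr_linear : linear corestr.
Proof. by move=> a x y; apply: val_inj; rewrite linearP /= linearP. Qed.

Definition sub_corestr : {linear U -> submodule N} := mklin corestr_linear.

End Corestr.

Fact ker_lin (f : {linear U -> V}) a x y :
  f x = 0 -> f y = 0 -> f (a *: x + y) = 0.
Proof. by move=> fx fy; rewrite linearP fx fy scaler0 addr0. Qed.

Definition ker (f : {linear U -> V}) : submodClosed U :=
  mksub (linear0 f) (@ker_lin f).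

Lemma kerP (f : {linear U -> V}) x : reflect (f x = 0) (x \in ker f).
Proof. exact: mksubP. Qed.

Fact im_lin (f : {linear U -> V}) a y z :
  (exists x, f x = y) -> (exists x, f x = z) -> exists x, f x = a *: y + z.
Proof. by case=> [u <-] [v <-]; exists (a *: u + v); rewrite linearP. Qed.

Definition im (f : {linear U -> V}) : submodClosed V :=
  mksub (ex_intro _ 0 (linear0 f)) (@im_lin f).

Lemma imP (f : {linear U -> V}) y : reflect (exists x, f x = y) (y \in im f).
Proof. exact: mksubP. Qed.

Fact presub_proof (N : submodClosed V) (f : {linear U -> V}) a x y :
  f x \in N -> f y \in N -> f (a *: x + y) \in N.
Proof. by move=> fx fy; rewrite linearP rpredD ?rpredZ. Qed.

Fact presub0 (N : submodClosed V) (f : {linear U -> V}) : f 0 \in N.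
Proof. by rewrite linear0 rpred0. Qed.

Definition presub (N : submodClosed V) (f : {linear U -> V}) : submodClosed U :=
  mksub (presub0 N f) (@presub_proof N f).

Lemma presubP (N : submodClosed V) (f : {linear U -> V}) x :
  reflect (f x \in N) (x \in presub N f).
Proof. exact: mksubP. Qed.

Fact sub0_proof a (x y : U) : x = 0 -> y = 0 -> a *: x + y = 0.
Proof. by move=> -> ->; rewrite scaler0 addr0. Qed.

Definition sub0 : submodClosed U := mksub (erefl 0) sub0_proof.

Lemma sub0P x : reflect (x = 0) (x \in sub0).
Proof. exact: mksubP. Qed.

End Universal.
Arguments sub0 {R} U.

Definition Ker (R : pzRingType) (U V : lmodType R) (f : {linear U -> V}) :
  lmodType R := submodule (ker f).

Definition Coker (R : pzRingType) (U V : lmodType R) (f : {linear U -> V}) :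
  lmodType R := quotmod (im f).

Definition exact_at (R : pzRingType) (U V W : lmodType R)
    (f : {linear U -> V}) (g : {linear V -> W}) :=
  forall y, g y = 0 <-> exists x, f x = y.

Section HomModule.
Variables (R : comPzRingType) (N X : lmodType R).

Let H := {linear N -> X}.
HB.instance Definition _ := gen_eqMixin H.
HB.instance Definition _ := gen_choiceMixin H.

Definition lin_add (f g : H) : H := f \+ g.
Definition lin_opp (f : H) : H := \- f.
Definition lin_scale (a : R) (f : H) : H := a \*: f.
Definition lin_zero : H := \0.

Let addA : associative lin_add.
Proof. by move=> f g h; apply: linear_ext => x /=; rewrite addrA. Qed.
Let addC : commutative lin_add.
Proof. by move=> f g; apply: linear_ext => x /=; rewrite addrC. Qed.
Let add0 : left_id lin_zero lin_add.
Proof. by move=> f; apply: linear_ext => x /=; rewrite add0r. Qed.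
Let addN : left_inverse lin_zero lin_opp lin_add.
Proof. by move=> f; apply: linear_ext => x /=; rewrite addNr. Qed.
HB.instance Definition _ := GRing.isZmodule.Build H addA addC add0 addN.

Let scaleA a b f : lin_scale a (lin_scale b f) = lin_scale (a * b) f.
Proof. by apply: linear_ext => x /=; rewrite scalerA. Qed.
Let scale1 : left_id 1 lin_scale.
Proof. by move=> f; apply: linear_ext => x /=; rewrite scale1r. Qed.
Let scaleDr : right_distributive lin_scale +%R.
Proof. by move=> a f g; apply: linear_ext => x /=; rewrite scalerDr. Qed.
Let scaleDl f : {morph lin_scale^~ f : a b / a + b}.
Proof. by move=> a b; apply: linear_ext => x /=; rewrite scalerDl. Qed.
HB.instance Definition _ := GRing.Zmodule_isLmodule.Build R H
  scaleA scale1 scaleDr scaleDl.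

End HomModule.

Definition HomM (R : comPzRingType) (N X : lmodType R) : lmodType R :=
  {linear N -> X}.

Section Functors.
Variable R : comPzRingType.

(* Additivity is not a field: it follows from fmap_exact (see fmap0 for the
   preservation of zero maps). *)
Record left_exact_functor := LeftExactFunctor {
  fobj :> lmodType R -> lmodType R;
  fmap : forall X Y : lmodType R, {linear X -> Y} -> {linear fobj X -> fobj Y};
  fmap_id : forall X : lmodType R, fmap (idfun : {linear X -> X}) =1 idfun;
  fmap_comp : forall (X Y Z : lmodType R)
    (g : {linear Y -> Z}) (f : {linear X -> Y}),
    fmap (g \o f : {linear X -> Z}) =1 fmap g \o fmap f;
  fmap_exact : forall (X Y Z : lmodType R)
    (f : {linear X -> Y}) (g : {linear Y -> Z}),
    injective f -> exact_at f g ->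
    injective (fmap f) /\ exact_at (fmap f) (fmap g)
}.

Lemma fmap0 (G : left_exact_functor) (X Y : lmodType R) (f : {linear X -> Y}) :
  (forall x, f x = 0) -> forall x, fmap G f x = 0.
Proof.
move=> f0 x.
pose K := ker (idfun : {linear Y -> Y}).
pose Z : lmodType R := submodule K.
have Z0 (z : Z) : z = 0.
  have : sub_incl K z = 0 by case: z => z zK; exact: (kerP _ _ zK).
  by rewrite -(linear0 (sub_incl K)) => /val_inj.
have fker w : f w \in K by apply/kerP; exact: f0.
pose g : {linear X -> Z} := sub_corestr fker.
have -> : f = sub_incl K \o g by exact: linear_ext.
rewrite fmap_comp /=; set y := fmap G g x.
have [_ idK] : injective (fmap G (idfun : {linear Z -> Z})) /\
    exact_at (fmap G (idfun : {linear Z -> Z})) (fmap G (idfun : {linear Z -> Z})).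
  apply: fmap_exact => // z; split=> _; first by exists z.
  exact: Z0.
suff -> : y = 0 by rewrite linear0.
have := (idK y).2; rewrite fmap_id; apply; exists y; exact: fmap_id.
Qed.

Section HomFunctor.
Variable N : lmodType R.

Fact hom_map_linear (X Y : lmodType R) (f : {linear X -> Y}) :
  linear (fun g : HomM N X => f \o g : HomM N Y).
Proof. by move=> a g h; apply: linear_ext => x /=; rewrite linearP. Qed.

Definition hom_map (X Y : lmodType R) (f : {linear X -> Y}) :
  {linear HomM N X -> HomM N Y} := mklin (hom_map_linear f).

Fact hom_map_id (X : lmodType R) :
  hom_map (idfun : {linear X -> X}) =1 idfun.
Proof. by move=> f; exact: linear_ext. Qed.

Fact hom_map_comp (X Y Z : lmodType R)
    (g : {linear Y -> Z}) (f : {linear X -> Y}) :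
  hom_map (g \o f : {linear X -> Z}) =1 hom_map g \o hom_map f.
Proof. by move=> h; exact: linear_ext. Qed.

Fact hom_map_exact (X Y Z : lmodType R)
    (f : {linear X -> Y}) (g : {linear Y -> Z}) :
  injective f -> exact_at f g ->
  injective (hom_map f) /\ exact_at (hom_map f) (hom_map g).
Proof.
move=> f_inj fg; split.
  move=> h k hk; apply: linear_ext => x; apply: f_inj.
  exact: (congr1 (fun u : HomM N Y => u x) hk).
move=> h; split=> [gh0|[k <-]]; last first.
  by apply: linear_ext => x; apply/fg; exists (k x).
have P x : exists y, f y = h x.
  by apply/fg; exact: (congr1 (fun u : HomM N Z => u x) gh0).
pose k x := projT1 (cid (P x)).
have kE x : f (k x) = h x by rewrite /k; case: cid.
have kL : linear k by move=> a x y; apply: f_inj; rewrite linearP !kE linearP.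
by exists (mklin kL : HomM N X); apply: linear_ext => x; exact: kE.
Qed.

Definition HomF : left_exact_functor :=
  LeftExactFunctor hom_map_id hom_map_comp hom_map_exact.

End HomFunctor.

Record complex := Complex {
  cobj :> nat -> lmodType R;
  cdiff : forall n, {linear cobj n -> cobj n.+1};
  cdiffK : forall n x, cdiff n.+1 (cdiff n x) = 0
}.

Fact fcomplex_diffK (G : left_exact_functor) (C : complex) n x :
  fmap G (cdiff C n.+1) (fmap G (cdiff C n) x) = 0.
Proof. by rewrite -[LHS]fmap_comp; apply: fmap0; exact: cdiffK. Qed.

Definition fcomplex (G : left_exact_functor) (C : complex) : complex :=
  Complex (@fcomplex_diffK G C).

Definition cocycles (C : complex) n : submodClosed (C n) := ker (cdiff C n).

End Functors.

Section Cohomology.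
Variable R : comPzRingType.

Definition coboundaries (C : complex R) n : submodClosed (C n) :=
  match n with
  | 0 => sub0 (C 0)
  | m.+1 => im (cdiff C m)
  end.

Lemma coboundary_cocycle (C : complex R) n x :
  x \in coboundaries C n -> x \in cocycles C n.
Proof.
case: n x => [|n] x; first by move=> /sub0P ->; exact: rpred0.
by move=> /imP[y <-]; apply/kerP; exact: cdiffK.
Qed.

(* The coboundaries, as a submodule of the module of cocycles. *)
Definition coh_denom (C : complex R) n : submodClosed (submodule (cocycles C n)) :=
  presub (coboundaries C n) (sub_incl (cocycles C n)).

Definition cohomology (C : complex R) n : lmodType R := quotmod (coh_denom C n).

Record chain_map (C D : complex R) := ChainMap {
  cmap :> forall n, {linear C n -> D n};
  cmap_diff : forall n x, cmap n.+1 (cdiff C n x) = cdiff D n (cmap n x)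
}.

Section CohomologyMap.
Variables (C D : complex R) (f : chain_map C D) (n : nat).

Lemma cmap_cocycle (z : submodule (cocycles C n)) :
  (f n \o sub_incl (cocycles C n)) z \in cocycles D n.
Proof.
apply/kerP; case: z => z /= /kerP dz.
by rewrite -cmap_diff dz linear0.
Qed.

Lemma cmap_coboundary x :
  x \in coboundaries C n -> f n x \in coboundaries D n.
Proof.
case: (n) x => [|m] x; first by move=> /sub0P ->; apply/sub0P; exact: linear0.
by move=> /imP[y <-]; apply/imP; exists (f m y); rewrite cmap_diff.
Qed.

Lemma cmap_class z : z \in coh_denom C n ->
  (quot_proj (coh_denom D n) \o sub_corestr cmap_cocycle) z = 0.
Proof.
move=> /presubP zB; apply/proj_eq0/presubP; exact: cmap_coboundary.
Qed.

Definition coh_map : {linear cohomology C n -> cohomology D n} :=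
  quot_lift cmap_class.

End CohomologyMap.

Section Edge.
Variables (N : lmodType R) (C : complex R) (n : nat).
Let Z := cocycles C n.
Let HC := fcomplex (HomF N) C.

Lemma edge_cocycle (f : submodule (cocycles HC n)) (x : N) :
  (smval f : HomM N (C n)) x \in Z.
Proof.
apply/kerP; case: f => f fZ.
exact: (congr1 (fun u : HomM N (C n.+1) => u x) (kerP _ _ fZ)).
Qed.

Let edge0 (f : submodule (cocycles HC n)) : HomM N (cohomology C n) :=
  quot_proj (coh_denom C n) \o sub_corestr (edge_cocycle f).

Let edge0_linear : linear edge0.
Proof.
move=> a f g; apply: linear_ext => x.
pose e h := sub_corestr (edge_cocycle h) x.
rewrite -[RHS]/(a *: quot_proj (coh_denom C n) (e f) + quot_proj (coh_denom C n) (e g)).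
by rewrite -linearP; congr (quot_proj _ _); exact: val_inj.
Qed.

Lemma edge_coboundary (f : HomM N (C n)) (x : N) :
  f \in coboundaries HC n -> f x \in coboundaries C n.
Proof.
case: (n) f => [|m] f; first by move=> /sub0P ->; apply/sub0P.
by move=> /imP[h <-]; apply/imP; exists ((h : HomM N (C m)) x).
Qed.

Lemma edge0_class f : f \in coh_denom HC n -> mklin edge0_linear f = 0.
Proof.
move=> /presubP fB; apply: linear_ext => x; apply/proj_eq0/presubP.
exact: edge_coboundary fB.
Qed.

(* The class of a cocycle f : N -> C n is sent to x |-> [f x]. For C = G(E), E an
   injective resolution of M, this is the edge map
   R^n (Hom(N, G -))(M) -> Hom(N, G^n(M)) = E_2^(0,n) of the Grothendieck
   spectral sequence. *)
Definition edge : {linear cohomology HC n -> HomM N (cohomology C n)} :=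
  quot_lift edge0_class.

End Edge.
End Cohomology.

Section DivisibleExtension.
Variables (B D : zmodType).
Hypothesis Ddiv : forall (n : nat) (d : D), (0 < n)%N -> exists e, e *+ n = d.
Implicit Type A : set (B * D).

(* A is the graph of an additive map from a subgroup of B to D. *)
Definition partial_hom A :=
  [/\ A 0, forall p q, A p -> A q -> A (p - q)
    & forall p, A p -> p.1 = 0 -> p.2 = 0].

Let pN A p : partial_hom A -> A p -> A (- p).
Proof. by case=> A0 AB _ Ap; rewrite -[- p]add0r; exact: AB. Qed.

Let pD A p q : partial_hom A -> A p -> A q -> A (p + q).
Proof.
by move=> hA Ap Aq; rewrite -[q]opprK; case: (hA) => _ + _; apply => //; exact: pN.
Qed.

Let pMz A p k : partial_hom A -> A p -> A (p *~ k).
Proof.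
move=> hA Ap.
have Mn n : A (p *+ n).
  by elim: n => [|n IH]; [case: hA | rewrite mulrS; exact: pD].
by case: k => n; [exact: Mn | rewrite NegzE mulrNz; exact: pN (Mn _)].
Qed.

Let fstMz (p : B * D) k : (p *~ k).1 = p.1 *~ k.
Proof. exact: (raddfMz (@fst B D)). Qed.
Let sndMz (p : B * D) k : (p *~ k).2 = p.2 *~ k.
Proof. exact: (raddfMz (@snd B D)). Qed.

Let extend_value A b : partial_hom A -> exists d, forall p k, A p ->
  p.1 + b *~ k = 0 -> p.2 + d *~ k = 0.
Proof.
move=> hA; have [_ AB A1] := hA.
pose P n := (0 < n)%N && `[< exists y, A (b *+ n, y) >].
have [exP|nP] := pselect (exists n, P n).
  case: (ex_minnP exP) => n /andP[n0 /asboolP[y Ay]] nmin.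
  have [d dn] := Ddiv y n0; exists d => p k Ap pk.
  have pk' : - p.1 = b *~ k by rewrite -[- p.1]addr0 -pk addKr.
  pose s := - p - (b *+ n, y) *~ (k %/ n)%Z.
  have As : A s by apply: AB; [exact: pN | exact: pMz].
  have s1 : s.1 = b *~ (k %% n)%Z.
    rewrite /s /= fstMz /= pk' pmulrn -mulrzA -mulrzBr; congr (_ *~ _).
    by rewrite {1}(divz_eq k n) mulrC addrAC subrr add0r.
  have m0 : (k %% n)%Z = 0.
    have n0' : 0 < n%:Z by [].
    have := modz_ge0 k (lt0r_neq0 n0'); have := ltz_pmod k n0'.
    case: (k %% n)%Z s1 => // -[//|m] s1 lt _.
    have /nmin : P m.+1.
      by rewrite /P /=; apply/asboolP; exists s.2; rewrite -[b *+ _]/(b *~ m.+1%:Z) -s1 -surjective_pairing.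
    by rewrite leqNgt -ltz_nat lt.
  have := A1 _ As; rewrite s1 m0 => /(_ erefl).
  rewrite /s /= sndMz /= -dn pmulrn -mulrzA mulrC.
  rewrite [in d *~ k](divz_eq k n) m0 addr0.
  by rewrite -opprD => /eqP; rewrite oppr_eq0 => /eqP.
exists 0 => p k Ap pk; rewrite mul0rz addr0.
suff k0 : k = 0 by apply: A1 => //; move: pk; rewrite k0 mulr0z addr0.
apply: contrapT => /eqP k0; apply: nP; exists `|k|%N.
rewrite /P absz_gt0 k0 /=; apply/asboolP; exists (- p *~ sgz k).2.
suff -> : b *+ `|k| = (- p *~ sgz k).1.
  by rewrite -surjective_pairing; apply: pMz => //; exact: pN.
rewrite fstMz /= -[- p.1]addr0 -pk addKr -mulrzA mulrC -abszEsg.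
by rewrite pmulrn.
Qed.

(* Additive maps into a divisible group extend from subgroups. *)
Lemma partial_hom_extend A : partial_hom A ->
  exists g : {additive B -> D}, forall p, A p -> g p.1 = p.2.
Proof.
move=> hA.
pose P (X : set (B * D)) := X = set0 \/ partial_hom X /\ (A `<=` X)%classic.
have [F FP Ftot|M [PM Mmax]] := @Zorn_bigcup (B * D) P.
  have [allE|] := pselect (forall X, F X -> X = set0).
    by left; apply/seteqP; split=> // p [X /allE ->].
  move=> /existsNP[X /not_implyP[FX X0]].
  have good Y p : F Y -> Y p -> partial_hom Y /\ (A `<=` Y)%classic.
    by move=> /FP[-> //|].
  have [[X00 _ _] AX] : partial_hom X /\ (A `<=` X)%classic by case: (FP _ FX).
  right; split; last by move=> p Ap; exists X => //; exact: AX.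
  split; first by exists X.
  - move=> p q [Y FY Yp] [Z FZ Zq].
    have [YZ|ZY] := Ftot _ _ FY FZ.
      exists Z => //; have [[_ ZB _] _] := good _ _ FZ Zq; apply: ZB => //.
      exact: YZ.
    exists Y => //; have [[_ YB _] _] := good _ _ FY Yp; apply: YB => //.
    exact: ZY.
  - by move=> p [Y FY Yp]; have [[_ _ +] _] := good _ _ FY Yp; apply.
have [hM AM] : partial_hom M /\ (A `<=` M)%classic.
  case: PM => // M0; exfalso; apply: (Mmax A); last by right; split.
  rewrite M0; split=> // A0; case: hA => + _ _; exact: A0.
have total b : exists d, M (b, d).
  apply: contrapT => nb; have [d dP] := extend_value b hM.
  pose M' := [set p : B * D | exists q k, M q /\ p = q + (b, d) *~ k]%classic.
  have MM' : (M `<=` M')%classic by move=> p Mp; exists p, 0; rewrite mulr0z addr0.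
  apply: (Mmax M').
    split=> // M'M; apply: nb; exists d; apply: M'M; exists 0, 1.
    by rewrite mulr1z add0r; split=> //; case: hM.
  right; split; last exact: subset_trans MM'.
  split; first by apply: MM'; case: hM.
  - move=> _ _ [p [k [Mp ->]]] [q [l [Mq ->]]]; exists (p - q), (k - l).
    by split; [case: hM => _ + _; apply | rewrite mulrzBr opprD addrACA].
  - move=> _ [p [k [Mp ->]]] /=; rewrite fstMz sndMz; exact: dP.
pose g b := projT1 (cid (total b)).
have gM b : M (b, g b) by rewrite /g; case: cid.
have fM b d : M (b, d) -> g b = d.
  move=> Mb; case: (hM) => _ MB M1; apply/eqP; rewrite -subr_eq0; apply/eqP.
  by apply: (M1 _ (MB _ _ (gM b) Mb)) => /=; rewrite subrr.
have gB : GRing.zmod_morphism g.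
  by move=> x y; apply: fM; case: (hM) => _ MB _; exact: MB (gM x) (gM y).
pose gA : {additive B -> D} := HB.pack g (GRing.isZmodMorphism.Build B D g gB).
exists gA => -[b d] Ab.
exact/fM/AM.
Qed.

End DivisibleExtension.

Definition intQ : {pred rat} := fun q => q \is a Num.int.
Fact intQ_closed : zmod_closed intQ.
Proof. by split; [exact: rpred0 | exact: rpredB]. Qed.
HB.instance Definition _ := GRing.isZmodClosed.Build rat intQ intQ_closed.

Definition QZ : zmodType := Quotient.quot intQ.

Definition piQZ (q : rat) : QZ := \pi_(Quotient.quot intQ) q.

Lemma piQZ_additive : GRing.zmod_morphism piQZ.
Proof. by move=> x y; rewrite /piQZ Quotient.pi_add Quotient.pi_opp. Qed.
HB.instance Definition _ := GRing.isZmodMorphism.Build rat QZ piQZ piQZ_additive.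

Lemma piQZ_eq0 q : (piQZ q == 0) = (q \is a Num.int).
Proof.
rewrite -(raddf0 piQZ) /piQZ.
by have := @Quotient.idealrBE rat intQ q 0; rewrite subr0 => <-.
Qed.

Lemma QZ_divisible (n : nat) (d : QZ) : (0 < n)%N -> exists e, e *+ n = d.
Proof.
move=> n0; exists (piQZ (repr d / n%:R)); rewrite -raddfMn /=.
rewrite -(mulr_natr (repr d / _)) divfK ?pnatr_eq0 -?lt0n// /piQZ; exact: reprK.
Qed.

Lemma QZ_separates (X : zmodType) (x : X) : x != 0 ->
  exists phi : {additive X -> QZ}, phi x != 0.
Proof.
move=> x0.
have [d d0 dP] : exists2 d : QZ, d != 0 & forall k, x *~ k = 0 -> d *~ k = 0.
  have frac n : (1 < n)%N -> piQZ (n%:R^-1) != 0.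
    move=> n1; rewrite piQZ_eq0; apply/negP => /intrP[m mE].
    have n0 : 0 < n%:R :> rat by rewrite ltr0n ltnW.
    have m_gt0 : (0 : rat) < m%:~R by rewrite -mE invr_gt0.
    have m_lt1 : (m%:~R : rat) < 1.
      by rewrite -mE invf_lt1 ?ltr1n.
    move: m_gt0 m_lt1; rewrite ltr0z ltrz1; clear; by case: m => [[|m]|m].
  pose P n := (0 < n)%N && (x *+ n == 0).
  have [exP|nP] := pselect (exists n, P n); last first.
    exists (piQZ (2%:R^-1)); first exact: frac.
    move=> k xk; have [->|k0] := eqVneq k 0; first by rewrite mulr0z.
    case: nP; exists `|k|%N; rewrite /P absz_gt0 k0 /= pmulrn abszEsg mulrC.
    by rewrite mulrzA xk mul0rz.
  case: (ex_minnP exP) => n /andP[n0 /eqP xn] nmin.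
  have n1 : (1 < n)%N by case: n n0 xn {nmin} => // -[|//] _ /eqP; rewrite (negPf x0).
  exists (piQZ (n%:R^-1)); first exact: frac.
  move=> k xk; have kE : k = (k %/ n)%Z * n.
    have xr : x *~ (k %% n)%Z = 0.
      by rewrite /modz mulrzBr xk mulrC mulrzA -pmulrn xn mul0rz subrr.
    have n0' : 0 < n%:Z by [].
    have := modz_ge0 k (lt0r_neq0 n0'); have := ltz_pmod k n0'.
    have := divz_eq k n.
    case: (k %% n)%Z xr => // -[|m] xr kE lt _; first by rewrite {1}kE addr0.
    have /nmin : P m.+1 by rewrite /P /=; apply/eqP.
    by rewrite leqNgt -ltz_nat lt.
  rewrite kE mulrC mulrzA -pmulrn -raddfMn /= -(mulr_natr (_^-1)) mulVf ?pnatr_eq0 -?lt0n//.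
  suff -> : piQZ 1 = 0 by rewrite mul0rz.
  by apply/eqP; rewrite piQZ_eq0.
pose A := [set p : X * QZ | exists k, p = (x, d) *~ k]%classic.
have fstMz (p : X * QZ) k : (p *~ k).1 = p.1 *~ k by exact: (raddfMz (@fst X QZ)).
have sndMz (p : X * QZ) k : (p *~ k).2 = p.2 *~ k by exact: (raddfMz (@snd X QZ)).
have hA : partial_hom A.
  split.
  - by exists 0.
  - by move=> _ _ [k ->] [l ->]; exists (k - l); rewrite mulrzBr.
  - by move=> _ [k ->]; rewrite fstMz sndMz; exact: dP.
have [phi phiP] := partial_hom_extend QZ_divisible hA.
by exists phi; rewrite (phiP (x, d))//; exists 1.
Qed.

Lemma additive_ext (X Y : zmodType) (f g : {additive X -> Y}) : f =1 g -> f = g.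
Proof.
case: f g => f [[f1]] [g [[g1]]] /= /funext fg.
by subst g; rewrite (Prop_irrelevance f1 g1).
Qed.

(* The coinduced R-module of additive maps R -> Q/Z, with (a f)(r) = f (r a). *)
Section CharacterModule.
Variable R : pzRingType.

Record charmod := CharMod { chfun :> {additive R -> QZ} }.

Lemma charmod_ext (f g : charmod) : f =1 g -> f = g.
Proof. by case: f; case: g => g f fg; congr (CharMod _); exact: additive_ext. Qed.

HB.instance Definition _ := gen_eqMixin charmod.
HB.instance Definition _ := gen_choiceMixin charmod.

Definition mkch (f : R -> QZ) (fB : GRing.zmod_morphism f) : charmod :=
  CharMod (HB.pack_for {additive R -> QZ} f
    (GRing.isZmodMorphism.Build R QZ f fB)).

Fact ch_add_proof (f g : charmod) : GRing.zmod_morphism (fun r => f r + g r).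
Proof. by move=> r s; rewrite !raddfB opprD addrACA. Qed.
Fact ch_opp_proof (f : charmod) : GRing.zmod_morphism (fun r => - f r).
Proof. by move=> r s; rewrite raddfB opprD. Qed.
Fact ch_zero_proof : GRing.zmod_morphism (fun r : R => 0 : QZ).
Proof. by move=> r s; rewrite subrr. Qed.
Fact ch_scale_proof a (f : charmod) : GRing.zmod_morphism (fun r => f (r * a)).
Proof. by move=> r s; rewrite mulrBl raddfB. Qed.

Definition ch_add f g := mkch (ch_add_proof f g).
Definition ch_opp f := mkch (ch_opp_proof f).
Definition ch_zero := mkch ch_zero_proof.
Definition ch_scale a f := mkch (ch_scale_proof a f).

Let addA : associative ch_add.
Proof. by move=> f g h; apply: charmod_ext => r /=; rewrite addrA. Qed.
Let addC : commutative ch_add.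
Proof. by move=> f g; apply: charmod_ext => r /=; rewrite addrC. Qed.
Let add0 : left_id ch_zero ch_add.
Proof. by move=> f; apply: charmod_ext => r /=; rewrite add0r. Qed.
Let addN : left_inverse ch_zero ch_opp ch_add.
Proof. by move=> f; apply: charmod_ext => r /=; rewrite addNr. Qed.
HB.instance Definition _ := GRing.isZmodule.Build charmod addA addC add0 addN.

Let scaleA a b f : ch_scale a (ch_scale b f) = ch_scale (a * b) f.
Proof. by apply: charmod_ext => r /=; rewrite mulrA. Qed.
Let scale1 : left_id 1 ch_scale.
Proof. by move=> f; apply: charmod_ext => r /=; rewrite mulr1. Qed.
Let scaleDr : right_distributive ch_scale +%R.
Proof. by move=> a f g; exact: charmod_ext. Qed.
Let scaleDl f : {morph ch_scale^~ f : a b / a + b}.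
Proof. by move=> a b; apply: charmod_ext => r /=; rewrite mulrDr raddfD. Qed.
HB.instance Definition _ := GRing.Zmodule_isLmodule.Build R charmod
  scaleA scale1 scaleDr scaleDl.

Lemma charmod_extend (A B : lmodType R) (i : {linear A -> B})
    (f : {linear A -> charmod}) :
  injective i -> exists g : {linear B -> charmod}, forall a, g (i a) = f a.
Proof.
move=> i_inj.
pose G := [set p : B * QZ | exists a, p = (i a, f a 1)]%classic.
have hG : partial_hom G.
  split.
  - by exists 0; rewrite !linear0.
  - move=> _ _ [a ->] [b ->]; exists (a - b); rewrite !linearB.
    by congr (_, _).
  - move=> _ [a ->] /= ia0; have -> : a = 0 by apply: i_inj; rewrite linear0.
    by rewrite linear0.
have [g gP] := partial_hom_extend QZ_divisible hG.
have hP b : GRing.zmod_morphism (fun r : R => g (r *: b)).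
  by move=> r s; rewrite scalerBl raddfB.
have hL : linear (fun b => mkch (hP b)).
  move=> a x y; apply: charmod_ext => r /=.
  by rewrite scalerDr raddfD scalerA.
exists (mklin hL) => a; apply: charmod_ext => r /=.
rewrite -linearZ (gP (i (r *: a), f (r *: a) 1)); last by exists (r *: a).
by rewrite -[LHS]/(f (r *: a) 1) linearZ -[LHS]/(f a (1 * r)) mul1r.
Qed.

End CharacterModule.

Definition injective_module (R : pzRingType) (E : lmodType R) :=
  forall (A B : lmodType R) (i : {linear A -> B}) (f : {linear A -> E}),
  injective i -> exists g : {linear B -> E}, forall a, g (i a) = f a.

Section EnoughInjectives.
Variables (R : comPzRingType) (X : lmodType R).

(* An injective module containing X, not its injective envelope. *)
Definition inj_container : lmodType R := {additive X -> QZ} -> charmod R.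

Fact inj_container_embed1 (x : X) (phi : {additive X -> QZ}) :
  GRing.zmod_morphism (fun r : R => phi (r *: x)).
Proof. by move=> r s; rewrite scalerBl raddfB. Qed.

Fact inj_container_embed_linear :
  linear (fun x => (fun phi => mkch (inj_container_embed1 x phi)) : inj_container).
Proof.
move=> a x y; apply/funext => phi; apply: charmod_ext => r /=.
by rewrite scalerDr raddfD scalerA.
Qed.

Definition inj_embed : {linear X -> inj_container} := mklin inj_container_embed_linear.

Lemma inj_embed_inj : injective inj_embed.
Proof.
move=> x y xy; apply/eqP; rewrite -subr_eq0; apply: contrapT => /negP.
move=> /QZ_separates[phi] /eqP; apply.
have := congr1 (fun h : inj_container => h phi 1) xy.
by rewrite /= !scale1r raddfB => ->; rewrite subrr.
Qed.

Lemma inj_container_injective : injective_module inj_container.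
Proof.
move=> A B i f i_inj.
have fL phi : linear (fun a => (f a : inj_container) phi).
  by move=> r x y; rewrite linearP.
have P phi := charmod_extend (mklin (fL phi)) i_inj.
pose g phi := projT1 (cid (P phi)).
have gP phi a : g phi (i a) = (f a : inj_container) phi.
  by rewrite /g; case: cid => h /= ->.
have gL : linear (fun b => (fun phi => g phi b) : inj_container).
  by move=> r x y; apply/funext => phi; rewrite linearP.
by exists (mklin gL) => a; apply/funext => phi; exact: gP.
Qed.

End EnoughInjectives.

Record injective_resolution (R : comPzRingType) (M : lmodType R) :=
  InjectiveResolution {
    ires :> complex R;
    ires_aug : {linear M -> ires 0};
    ires_injective : forall n, injective_module (ires n);
    ires_aug_inj : injective ires_aug;
    ires_exact0 : exact_at ires_aug (cdiff ires 0);
    ires_exact : forall n, exact_at (cdiff ires n) (cdiff ires n.+1)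
}.

Lemma ires_exists (R : comPzRingType) (M : lmodType R) :
  $|injective_resolution M|.
Proof.
pose fix Q n : lmodType R :=
  if n is m.+1 then quotmod (im (inj_embed (Q m))) else M.
pose d n : {linear inj_container (Q n) -> inj_container (Q n.+1)} :=
  inj_embed (Q n.+1) \o quot_proj (im (inj_embed (Q n))).
have dE n y : d n y = 0 <-> exists x, inj_embed (Q n) x = y.
  pose K := im (inj_embed (Q n)); split=> [dy0|/imP yK].
    have py0 : quot_proj K y = 0 by apply: (@inj_embed_inj R); rewrite linear0.
    exact: (imP _ _ ((proj_eq0 K y).1 py0)).
  by rewrite -[LHS]/(inj_embed (Q n.+1) (quot_proj K y)) (proj_eq0 K y).2// linear0.
have dd n x : d n.+1 (d n x) = 0.
  by apply/dE; exists (quot_proj (im (inj_embed (Q n))) x).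
apply: squash; apply: (@InjectiveResolution R M (Complex dd) (inj_embed M)).
- by move=> n; exact: inj_container_injective.
- exact: inj_embed_inj.
- exact: (dE 0).
- move=> n y; split=> [/(dE n.+1)[x <-]|[x <-]]; last exact: dd.
  by have [z <-] := proj_surj x; exists z.
Qed.

(* Derived functors are computed from a resolution of each module fixed once and
   for all; unsquash picks an unspecified one. *)
Definition injres (R : comPzRingType) (M : lmodType R) :
  injective_resolution M := unsquash (ires_exists M).

Section DerivedFunctors.
Variable R : comPzRingType.

Definition rderived (G : left_exact_functor R) n (M : lmodType R) : lmodType R :=
  cohomology (fcomplex G (injres M)) n.

Definition Ext n (N X : lmodType R) : lmodType R := rderived (HomF N) n X.

End DerivedFunctors.

Section Ideals.
Variable R : comPzRingType.

Definition ideal := submodClosed (R^o : lmodType R).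

Definition noetherian := forall I : nat -> ideal,
  (forall n, {subset I n <= I n.+1}) ->
  exists m, forall n, (m <= n)%N -> {subset I n <= I m}.

Definition idmul (I J : {pred R}) : {pred R} := fun x =>
  `[< exists n (u v : 'I_n -> R),
      [/\ forall i, u i \in I, forall i, v i \in J & x = \sum_i u i * v i] >].

Fixpoint idexp (I : {pred R}) n : {pred R} :=
  if n is m.+1 then idmul I (idexp I m) else predT.

Definition idadd (I J : {pred R}) : {pred R} :=
  fun x => `[< exists y z, [/\ y \in I, z \in J & x = y + z] >].

Definition Wtilde (I J a : ideal) :=
  exists n, (1 <= n)%N /\ {subset idexp I n <= idadd a J}.

Definition cyclic_module (a : ideal) : lmodType R := quotmod a.

Section Colon.
Variables (a : ideal) (X : lmodType R).

Fact colon0 (r : R) : r \in a -> r *: (0 : X) = 0.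
Proof. by rewrite scaler0. Qed.

Fact colon_lin (b : R) (x y : X) :
  (forall r, r \in a -> r *: x = 0) -> (forall r, r \in a -> r *: y = 0) ->
  forall r, r \in a -> r *: (b *: x + y) = 0.
Proof.
move=> ax ay r ar.
by rewrite scalerDr scalerA mulrC -scalerA ax// ay// scaler0 addr0.
Qed.

Definition colon : submodClosed X :=
  @mksub R X (fun x => forall r, r \in a -> r *: x = 0) colon0 colon_lin.

Lemma colonP x : reflect (forall r, r \in a -> r *: x = 0) (x \in colon).
Proof. exact: mksubP. Qed.

Lemma hom_colon_proof (f : HomM (cyclic_module a) X) : f (quot_proj a (1 : R^o)) \in colon.
Proof.
apply/colonP => r ar; rewrite -!linearZ -[RHS](linear0 f); congr (f _).
by apply/proj_eq0; rewrite /= [_ *: _]mulr1.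
Qed.

Fact hom_colon_linear : linear (fun f => SubModule (hom_colon_proof f)).
Proof. by move=> b f g; exact: val_inj. Qed.

Definition hom_colon : {linear HomM (cyclic_module a) X -> submodule colon} :=
  mklin hom_colon_linear.

Fact colon_hom_mul (x : X) : linear (fun r : R^o => r *: x).
Proof. by move=> b r s; rewrite scalerDl scalerA. Qed.

Fact colon_hom_proof (x : submodule colon) r :
  r \in a -> mklin (colon_hom_mul (smval x)) r = 0.
Proof. by case: x => x /= /colonP; apply. Qed.

Fact colon_hom_linear :
  linear (fun x => quot_lift (@colon_hom_proof x) : HomM (cyclic_module a) X).
Proof.
move=> b x y; apply: linear_ext => z; have [r <-] := proj_surj z.
transitivity (r *: (b *: smval x + smval y)); first exact: quot_liftE.
rewrite scalerDr scalerA mulrC -scalerA.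
by congr (_ *: _ + _); apply/esym; exact: quot_liftE.
Qed.

Definition colon_hom : {linear submodule colon -> HomM (cyclic_module a) X} :=
  mklin colon_hom_linear.

Lemma hom_colonK : cancel hom_colon colon_hom.
Proof.
move=> f; apply: linear_ext => z; have [r <-] := proj_surj z.
transitivity (r *: smval (hom_colon f)); first exact: quot_liftE.
transitivity (f (quot_proj a ((r : R) *: (1 : R^o)))); first by rewrite !linearZ.
by congr (f (quot_proj a _)); exact: mulr1.
Qed.

Lemma colon_homK : cancel colon_hom hom_colon.
Proof.
move=> x; apply: val_inj.
exact: etrans (quot_liftE (@colon_hom_proof x) (1 : R^o)) (scale1r _).
Qed.

End Colon.

Section ColonMap.
Variables (a : ideal) (X Y : lmodType R) (f : {linear X -> Y}).

Fact colon_map_proof (x : submodule (colon a X)) :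
  (f \o sub_incl (colon a X)) x \in colon a Y.
Proof.
by case: x => x /= /colonP ax; apply/colonP => r /ax rx; rewrite -linearZ rx linear0.
Qed.

Definition colon_map : {linear submodule (colon a X) -> submodule (colon a Y)} :=
  sub_corestr colon_map_proof.

Lemma hom_colon_nat (g : HomM (cyclic_module a) X) :
  hom_colon a Y (hom_map (cyclic_module a) f g) = colon_map (hom_colon a X g).
Proof. exact: val_inj. Qed.

End ColonMap.

(* The hypothesis (0 :_X a) = (0 :_(G X) a) for all X, that is FG = F for
   F = Hom(R/a, -). For an abstract functor G, the two sides are not subsets of a
   common module, so the equality is an identification of functors, that is a
   natural isomorphism. *)
Record colon_iso (a : ideal) (G : left_exact_functor R) := ColonIso {
  ciso :> forall X : lmodType R,
    {linear submodule (colon a X) -> submodule (colon a (G X))};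
  ciso_bij : forall X, bijective (ciso X);
  ciso_nat : forall (X Y : lmodType R) (f : {linear X -> Y}) x,
    ciso Y (colon_map a f x) = colon_map a (fmap G f) (ciso X x)
}.

Section Psi.
Variables (a : ideal) (G : left_exact_functor R) (theta : colon_iso a G).
Let F := HomF (cyclic_module a).

Definition hom_ciso (X : lmodType R) : {linear F X -> F (G X)} :=
  colon_hom a (G X) \o (theta X \o hom_colon a X).

Lemma hom_ciso_nat (X Y : lmodType R) (f : {linear X -> Y}) (g : F X) :
  hom_ciso Y (fmap F f g) = fmap F (fmap G f) (hom_ciso X g).
Proof.
apply: (can_inj (@hom_colonK a (G Y))).
transitivity (theta Y (hom_colon a Y (fmap F f g))); first exact: colon_homK.
transitivity (colon_map a (fmap G f) (hom_colon a (G X) (hom_ciso X g))); last first.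
  exact/esym/hom_colon_nat.
have -> : hom_colon a (G X) (hom_ciso X g) = theta X (hom_colon a X g).
  exact: colon_homK.
by rewrite -ciso_nat -hom_colon_nat.
Qed.

Definition psi_chain (C : complex R) :
    chain_map (fcomplex F C) (fcomplex F (fcomplex G C)) :=
  @ChainMap R (fcomplex F C) (fcomplex F (fcomplex G C))
    (fun n => hom_ciso (C n)) (fun n => hom_ciso_nat (cdiff C n)).

(* Ext^t(R/a, M) = R^t F (M) is identified with R^t (FG)(M) through theta, and
   then mapped to F(G^t(M)) by the edge map. *)
Definition psi t (M : lmodType R) :
    {linear Ext t (cyclic_module a) M -> HomM (cyclic_module a) (rderived G t M)} :=
  edge (cyclic_module a) (fcomplex G (injres M)) t \o
  coh_map (psi_chain (injres M)) t.

End Psi.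

(* serre0 only excludes the empty class, which satisfies the other three. *)
Record serre (S : lmodType R -> Prop) : Prop := Serre {
  serre0 : forall Z : lmodType R, (forall z : Z, z = 0) -> S Z;
  serre_sub : forall (X Y : lmodType R) (f : {linear X -> Y}),
    injective f -> S Y -> S X;
  serre_quot : forall (X Y : lmodType R) (f : {linear X -> Y}),
    (forall y, exists x, f x = y) -> S X -> S Y;
  serre_ext : forall (X Y Z : lmodType R) (f : {linear X -> Y}) (g : {linear Y -> Z}),
    injective f -> exact_at f g -> (forall z, exists y, g y = z) ->
    S X -> S Z -> S Y
}.

End Ideals.

(* Main.v *)
(* Put N = R/a and C = G(E), E an injective resolution of M. Then C is a complex
   of injectives with cohomology G^j(M), and Hom(N, E) = Hom(N, C), so psi is the
   edge map H^t(Hom(N, C)) -> Hom(N, H^t(C)). With cocycles Z^n and coboundaries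
   B^n of C, the sequences 0 -> Z^(t-1) -> C^(t-1) -> B^t -> 0 and
   0 -> B^t -> Z^t -> H^t -> 0 identify its kernel with Ext^1(N, Z^(t-1)) and embed
   its cokernel in Ext^1(N, B^t) = Ext^2(N, Z^(t-1)). The same sequences in lower
   degrees filter Ext^i(N, Z^s) by subquotients of Ext^(i+s-j)(N, H^j), j <= s,
   which replaces the Grothendieck spectral sequence. *)
Require Import Defs.
From mathcomp Require Import all_boot all_order all_algebra.
From mathcomp Require Import boolp.
Import GRing.Theory.
Local Open Scope ring_scope.
Set Implicit Arguments. Unset Strict Implicit. Unset Printing Implicit Defensive.

(** * Short exact sequences: the horseshoe lemma and Schanuel's lemma *)

Section LinearAlgebra.
Variable R : comPzRingType.
Implicit Types X Y Z T E Q : lmodType R.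

Definition short_exact X Y Z (f : {linear X -> Y}) (g : {linear Y -> Z}) :=
  [/\ injective f, exact_at f g & forall z, exists y, g y = z].

Fact lin_pair_linear X Y Z (f : {linear X -> Y}) (g : {linear X -> Z}) :
  linear (fun x => (f x, g x) : Y * Z).
Proof. by move=> a x y; rewrite !linearP. Qed.

Definition lin_pair X Y Z (f : {linear X -> Y}) (g : {linear X -> Z}) :
  {linear X -> (Y * Z)%type} := mklin (@lin_pair_linear X Y Z f g).

Lemma factor_surj Y Z T (g : {linear Y -> Z}) (h : {linear Y -> T}) :
  (forall z, exists y, g y = z) -> (forall y, g y = 0 -> h y = 0) ->
  exists k : {linear Z -> T}, forall y, k (g y) = h y.
Proof.
move=> g_surj gh; pose s z := projT1 (cid (g_surj z)).
have sE z : g (s z) = z by rewrite /s; case: cid.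
have hs y : h (s (g y)) = h y.
  by apply/eqP; rewrite -subr_eq0 -linearB gh// linearB sE subrr.
have kL : linear (fun z => h (s z)).
  by move=> a y z; rewrite -{1}[y]sE -{1}[z]sE -linearP hs linearP.
by exists (mklin kL).
Qed.

Lemma short_exact_coker X Y (f : {linear X -> Y}) :
  injective f -> short_exact f (quot_proj (im f)).
Proof.
move=> f_inj; split=> //; last exact: proj_surj.
move=> y; split=> [/proj_eq0/imP//|xy]; exact/proj_eq0/imP.
Qed.

Lemma short_exact_quot X (N : submodClosed X) :
  short_exact (sub_incl N) (quot_proj N).
Proof.
split; [exact: val_inj| |exact: proj_surj].
move=> y; split=> [/proj_eq0 yN|[[x xN] <-]]; last exact/proj_eq0.
by exists (SubModule yN).
Qed.

Lemma injective_module_prod E E' :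
  injective_module E -> injective_module E' -> injective_module (E * E')%type.
Proof.
move=> inE inE' A B i f i_inj.
have L1 : linear (fun a => (f a).1) by move=> c x y; rewrite linearP.
have L2 : linear (fun a => (f a).2) by move=> c x y; rewrite linearP.
have [g1 g1E] := inE _ _ i (mklin L1) i_inj.
have [g2 g2E] := inE' _ _ i (mklin L2) i_inj.
exists (lin_pair g1 g2) => a.
by rewrite [RHS]surjective_pairing /= g1E g2E.
Qed.

Lemma injective_module0 X : (forall x : X, x = 0) -> injective_module X.
Proof.
move=> X0 A B i f _; exists (\0 : {linear B -> X}) => a.
by rewrite [RHS]X0.
Qed.

(** Injectivity of [E] extends [f1] along [f] to [u : Y -> E], and [u] paired with [f2 \o g] embeds
    [Y] in [E * E']. The map [p] is its cokernel, and [a], [b] are induced by the inclusion of [E]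
    and the projection to [E'], as in the 3 x 3 lemma. *)
Lemma horseshoe X Y Z E Q E' Q'
    (f : {linear X -> Y}) (g : {linear Y -> Z})
    (f1 : {linear X -> E}) (g1 : {linear E -> Q})
    (f2 : {linear Z -> E'}) (g2 : {linear E' -> Q'}) :
  injective_module E ->
  short_exact f g -> short_exact f1 g1 -> short_exact f2 g2 ->
  exists (T : lmodType R) (k : {linear Y -> (E * E')%type})
    (p : {linear (E * E')%type -> T}) (a : {linear Q -> T}) (b : {linear T -> Q'}),
    [/\ short_exact k p, short_exact a b, forall x, a (g1 x) = p (x, 0)
      & forall x, b (p x) = g2 x.2].
Proof.
move=> Einj [f_inj fg g_surj] [f1_inj fg1 g1_surj] [f2_inj fg2 g2_surj].
have [u uE] := Einj _ _ f f1 f_inj.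
pose k := lin_pair u (f2 \o g : {linear Y -> E'}).
have k_inj : injective k.
  move=> x y [uxy /f2_inj gxy]; apply/eqP; rewrite -subr_eq0; apply/eqP.
  have /fg[z zE] : g (x - y) = 0 by rewrite linearB gxy subrr.
  have : u (x - y) = 0 by rewrite linearB uxy subrr.
  rewrite -zE uE -(linear0 f1) => /f1_inj ->; exact: linear0.
have kp := short_exact_coker k_inj.
set p := quot_proj (im k) in kp; case: (kp) => _ kpE p_surj.
have L1 : linear (fun x => p (x, 0)).
  by move=> c x y; rewrite -linearP; congr (p (_, _)); rewrite /= scaler0 addr0.
have [x /fg1[z <-]|a aE] := factor_surj (h := mklin L1) g1_surj.
  by apply/kpE; exists (f z); rewrite /= uE (proj2 (fg _)) ?linear0//; exists z.
have L2 : linear (fun x : E * E' => g2 x.2) by move=> c x y; rewrite linearP.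
have [x /kpE[y <-]|b bE] := factor_surj (h := mklin L2) p_surj.
  by apply/fg2; exists (g y).
exists _, k, p, a, b; split=> //; split.
- move=> q q'; have [x <-] := g1_surj q; have [x' <-] := g1_surj q'.
  move=> /eqP; rewrite -subr_eq0 -(linearB a) -(linearB g1) => /eqP.
  rewrite aE => /kpE[y [uy /eqP]].
  rewrite -(linear0 f2) => /eqP/f2_inj/fg[z zE].
  apply/eqP; rewrite -subr_eq0 -(linearB g1); apply/eqP/fg1; exists z.
  by rewrite -uy -zE uE.
- move=> y; have [[x x'] <-] := p_surj y; rewrite bE /=; split.
    (* Subtracting [k w] from [(x, x')] clears the second coordinate and leaves [x - u w] in [E]. *)
    move=> /fg2[z zE]; have [w wz] := g_surj z; exists (g1 (x - u w)).
    rewrite aE /=; apply/eqP; rewrite -subr_eq0 -(linearB p); apply/eqP/kpE.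
    exists (- w); rewrite /= !linearN wz zE; congr (_, _) => /=.
      by rewrite addrAC subrr add0r.
    by rewrite add0r.
  move=> [q]; have [z <-] := g1_surj q; rewrite aE => /(congr1 b).
  by rewrite !bE /= linear0.
- move=> z; have [x <-] := g2_surj z; exists (p (0, x)); exact: bE.
Qed.

(* The pushout of Y and E along X is an extension of Z by E, hence split: it is
   Z x E. *)
Lemma schanuel X Y Z E Q
    (f : {linear X -> Y}) (g : {linear Y -> Z})
    (f1 : {linear X -> E}) (g1 : {linear E -> Q}) :
  injective_module E -> short_exact f g -> short_exact f1 g1 ->
  exists (u : {linear Y -> (Z * E)%type}) (v : {linear Z -> Q})
    (w : {linear (Z * E)%type -> Q}),
    [/\ short_exact u w, forall y, (u y).1 = g y
      & forall x, w x = g1 x.2 - v x.1].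
Proof.
move=> Einj [f_inj fg g_surj] [f1_inj fg1 g1_surj].
have [u uE] := Einj _ _ f f1 f_inj.
have [y /fg[x <-]|v vE] := factor_surj (h := g1 \o u : {linear Y -> Q}) g_surj.
  by apply/fg1; exists x.
have wL : linear (fun x : Z * E => g1 x.2 - v x.1).
  by move=> c x y; rewrite (linearP g1) (linearP v) scalerBr opprD addrACA.
exists (lin_pair g u), v, (mklin wL); split=> //; split.
- move=> x y [gxy uxy]; apply/eqP; rewrite -subr_eq0; apply/eqP.
  have /fg[z zE] : g (x - y) = 0 by rewrite linearB gxy subrr.
  have : u (x - y) = 0 by rewrite linearB uxy subrr.
  rewrite -zE uE -(linear0 f1) => /f1_inj ->; exact: linear0.
- move=> [z e] /=; split=> [|[y [<- <-]]]; last by rewrite vE subrr.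
  have [y <-] := g_surj z; rewrite vE /= -linearB => /fg1[x xE].
  exists (y + f x); rewrite /= (linearD u) (linearD g) uE xE.
  by rewrite [u y + _]addrC subrK (proj2 (fg (f x))) ?addr0//; exists x.
- by move=> q; have [e <-] := g1_surj q; exists (0, e); rewrite /= linear0 subr0.
Qed.

End LinearAlgebra.

(** * Membership in a Serre class along exact sequences *)

Section SerreSubcategory.
Variables (R : comPzRingType) (S : lmodType R -> Prop).
Hypothesis S_serre : serre S.
Implicit Types A B C X Y Z T E Q : lmodType R.

(** The inclusion of kernels makes [q] factor through the image of [p], so [Y] is a quotient of a
    submodule of [X]. *)
Lemma serre_subquotient A X Y (p : {linear A -> X}) (q : {linear A -> Y}) :
  (forall y, exists a, q a = y) -> (forall a, p a = 0 -> q a = 0) -> S X -> S Y.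
Proof.
move=> q_surj pq SX.
have pim x : p x \in im p by apply/imP; exists x.
have cor_surj z : exists x, sub_corestr pim x = z.
  by case: z => z zp; have /imP[x xz] := zp; exists x; exact: val_inj.
have [x /(congr1 val) /= px0|h hE] := factor_surj (h := q) cor_surj.
  exact: pq.
apply: (serre_quot S_serre (f := h)).
  by move=> y; have [a <-] := q_surj y; exists (sub_corestr pim a).
by apply: (serre_sub S_serre (f := sub_incl (im p))) => //; exact: val_inj.
Qed.

(** [B] is an extension of the image of [g], a submodule of [C], by the kernel of [g], which is the
    image of [f] and hence a subquotient of [X]. Taking [p] apart from [f] allows [A] to be a module
    of representatives outside [S]. *)
Lemma serre_middle A B C X (f : {linear A -> B}) (g : {linear B -> C})
    (p : {linear A -> X}) :
  exact_at f g -> (forall a, p a = 0 -> f a = 0) -> S X -> S C -> S B.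
Proof.
move=> fg pf SX SC.
have fker a : f a \in ker g by apply/kerP/fg; exists a.
have gim b : g b \in im g by apply/imP; exists b.
apply: (serre_ext S_serre (f := sub_incl (ker g)) (g := sub_corestr gim)).
- exact: val_inj.
- move=> b; split=> [/(congr1 val) /= gb|[[x xg] <-]].
    have gb' : b \in ker g by apply/kerP.
    by exists (SubModule gb').
  by apply: val_inj; exact: (kerP _ _ xg).
- by case=> c cg; have /imP[b bc] := cg; exists b; exact: val_inj.
- apply: (serre_subquotient (p := p) (q := sub_corestr fker)) => //.
    by case=> b bg; have /kerP/fg[a ab] := bg; exists a; exact: val_inj.
  by move=> a /pf fa; exact: val_inj.
- by apply: (serre_sub S_serre (f := sub_incl (im g))) => //; exact: val_inj.
Qed.

Lemma serre_coker A B X (f : {linear A -> B}) (p : {linear B -> X}) :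
  (forall b, p b = 0 -> exists a, f a = b) -> S X -> S (Coker f).
Proof.
move=> pf; apply: (serre_subquotient (p := p) (q := quot_proj (im f))).
  exact: proj_surj.
by move=> b /pf bf; apply/proj_eq0/imP.
Qed.

(** * Ext modules in positive degree by dimension shifting *)

Section ShiftedExt.
Variable N : lmodType R.

(* For any choice of the injective embeddings this says that Ext^(i+1)(N, X)
   lies in S; asserting only that one choice exists makes the long exact
   sequence available without comparing resolutions. *)
Fixpoint shifted_ext i X : Prop :=
  exists (E Q : lmodType R) (f : {linear X -> E}) (g : {linear E -> Q}),
    [/\ injective_module E, short_exact f g
      & if i is j.+1 then shifted_ext j Q else S (Coker (hom_map N g))].

Lemma shifted_extE i X : shifted_ext i X =
  exists (E Q : lmodType R) (f : {linear X -> E}) (g : {linear E -> Q}),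
    [/\ injective_module E, short_exact f g
      & if i is j.+1 then shifted_ext j Q else S (Coker (hom_map N g))].
Proof. by case: i. Qed.

(** The sequence 0 -> E -> E -> 0 -> 0 serves as the start of a resolution; its last term is again
    injective, so the induction goes on. *)
Lemma shifted_ext_injective i E : injective_module E -> shifted_ext i E.
Proof.
have Z0 (F : lmodType R) (z : submodule (sub0 F)) : z = 0.
  by case: z => z z0; apply: val_inj; exact/sub0P.
have exF (F : lmodType R) : short_exact (idfun : {linear F -> F})
    (\0 : {linear F -> submodule (sub0 F)}).
  split=> // [y|z]; last by exists 0; rewrite [RHS]Z0.
  by split=> // _; exists y.
elim: i E => [|i IH] E Einj; exists E, (submodule (sub0 E)), idfun, \0; split=> //.
  apply: (serre0 S_serre) => x; have [h <-] := proj_surj x.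
  by apply/proj_eq0/imP; exists 0; apply: linear_ext => n; rewrite [RHS]Z0.
exact: IH (injective_module0 (@Z0 E)).
Qed.

(** This is the part Ext(N, X) -> Ext(N, Y) -> Ext(N, Z) of the long exact sequence. The horseshoe
    lemma passes to the cokernels and lowers [i]; for [i = 0] the cokernels of [hom_map N g1],
    [hom_map N p] and [hom_map N g2] form a sequence exact in the middle. *)
Lemma shifted_ext_middle i X Y Z (f : {linear X -> Y}) (g : {linear Y -> Z}) :
  short_exact f g -> shifted_ext i X -> shifted_ext i Z -> shifted_ext i Y.
Proof.
elim: i X Y Z f g => [|i IH] X Y Z f g fg [E [Q [f1 [g1 [Einj fg1 QS]]]]]
  [E' [Q' [f2 [g2 [Einj' fg2 QS']]]]].
all: have [T [k [p [a [b [kp ab aE bE]]]]]] := horseshoe Einj fg fg1 fg2.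
all: exists (E * E')%type, T, k, p; split=> //; first exact: injective_module_prod.
  have pb h : h \in im (hom_map N p) ->
      (quot_proj (im (hom_map N g2)) \o hom_map N b) h = 0.
    move=> /imP[l <-]; apply/proj_eq0/imP.
    have lL : linear (fun x => (l x).2) by move=> c x y; rewrite linearP.
    by exists (mklin lL); apply: linear_ext => x /=; rewrite bE.
  apply: (serre_middle (f := quot_proj (im (hom_map N p)) \o hom_map N a)
    (g := quot_lift pb) (p := quot_proj (im (hom_map N g1)))) => //.
    case: ab => a_inj ab _; have [ha_inj hab] := hom_map_exact N a_inj ab.
    move=> y; have [h <-] := proj_surj y; rewrite quot_liftE; split.
      move=> /proj_eq0/imP[l lE].
      (* A lift [l] of [b \o h] to [E'] gives a map [m] that is zero in the cokernel; [h - m] is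
         killed by [b], hence comes from [Q]. *)
      pose m := p \o (lin_pair \0 l : {linear N -> (E * E')%type}) : {linear N -> T}.
      have /hab[q qE] : hom_map N b (h - m : HomM N T) = 0.
        apply: linear_ext => x; rewrite /= linearB bE /=.
        have := congr1 (fun u : HomM N Q' => u x) lE; rewrite /= => ->.
        by rewrite subrr.
      exists q; apply/eqP.
      rewrite -subr_eq0 -(linearB (quot_proj (im (hom_map N p)))).
      apply/eqP/proj_eq0/imP.
      exists (lin_pair \0 (\- l) : {linear N -> (E * E')%type}).
      apply: linear_ext => x.
      have := congr1 (fun u : HomM N T => u x) qE; rewrite /= => ->.
      rewrite addrAC subrr add0r -(linearN p); congr (p (_, _)); exact/esym/oppr0.
    move=> [q qE]; rewrite -(quot_liftE pb) -qE quot_liftE.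
    have baq : hom_map N b (hom_map N a q) = 0 by apply/hab; exists q.
    exact: etrans (congr1 (quot_proj _) baq) (linear0 _).
  move=> q /proj_eq0/imP[l <-]; apply/proj_eq0/imP.
  exists (lin_pair l \0 : {linear N -> (E * E')%type}).
  by apply: linear_ext => x; rewrite /= aE.
exact: IH ab QS QS'.
Qed.

(** An embedding of [Q * E] in [D] with cokernel [P] restricts to one of [Q], and 0 -> E -> D/Q -> P
    -> 0 is exact. For [i > 0] this carries the property from [P] to [D/Q], as [E] is injective; for
    [i = 0] a map to [D/Q] whose image in [P] lifts to [D] lifts itself, the error being a map to
    [E]. *)
Lemma shifted_ext_factor i Q E : injective_module E ->
  shifted_ext i (Q * E)%type -> shifted_ext i Q.
Proof.
move=> Einj; rewrite shifted_extE.
move=> [D [P [k [g [Dinj [k_inj kg g_surj] PS]]]]].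
pose f := k \o (lin_pair idfun \0 : {linear Q -> (Q * E)%type}) : {linear Q -> D}.
pose e := k \o (lin_pair \0 idfun : {linear E -> (Q * E)%type}) : {linear E -> D}.
have f_inj : injective f by move=> x y /k_inj[].
have fp := short_exact_coker f_inj; case: (fp) => _ fpE p_surj.
set p := quot_proj (im f) in fp fpE p_surj.
have [x /fpE[y <-]|b bE] := factor_surj (h := g) p_surj.
  by apply/kg; eexists.
have ab : short_exact (p \o e : {linear E -> quotmod (im f)}) b.
  split.
  - move=> x y /eqP; rewrite -subr_eq0 -linearB => /eqP/fpE[z].
    by move=> /k_inj[_ /eqP]; rewrite eq_sym subr_eq0 => /eqP.
  - move=> t; have [x <-] := p_surj t; rewrite bE; split.
      move=> /kg[[y z] <-]; exists z; apply/eqP.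
      rewrite -subr_eq0 -(linearB p); apply/eqP/fpE.
      exists (- y); rewrite /= -(linearB k); congr (k (_, _)) => /=.
        by rewrite add0r.
      by rewrite subrr.
    by move=> [y /(congr1 b)]; rewrite /= !bE => <-; apply/kg; eexists.
  - by move=> y; have [x <-] := g_surj y; exists (p x).
case: i PS => [|i] PS; exists D, (quotmod (im f)), f, p; split=> //.
  case: ab => a_inj ab _; have [_ hab] := hom_map_exact N a_inj ab.
  apply: (serre_coker (p := quot_proj (im (hom_map N g)) \o hom_map N b) _ PS).
  move=> h /proj_eq0/imP[l lE].
  have /hab[m mE] : hom_map N b (h - hom_map N p l : HomM N (quotmod (im f))) = 0.
    apply: linear_ext => x; rewrite /= (linearB b) bE.
    have := congr1 (fun u : HomM N P => u x) lE; rewrite /= => ->.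
    by rewrite subrr.
  have emE : hom_map N p (hom_map N e m) = h - hom_map N p l.
    by rewrite -mE; exact: linear_ext.
  by exists (l + hom_map N e m); rewrite linearD emE addrC subrK.
by apply: shifted_ext_middle ab _ PS; exact: shifted_ext_injective.
Qed.

(** This is the part Ext(N, Y) -> Ext(N, Z) -> Ext(N, X) with the degree raised by one at [X]. By
    Schanuel, [Z * E] is an extension of [Q] by [Y], where [Q] is a cosyzygy of [X]; then the
    injective factor [E] is dropped. *)
Lemma shifted_ext_connecting i X Y Z (f : {linear X -> Y}) (g : {linear Y -> Z}) :
  short_exact f g -> shifted_ext i.+1 X -> shifted_ext i Y -> shifted_ext i Z.
Proof.
move=> fg [E [Q [f1 [g1 [Einj fg1 QS]]]]] YS.
have [u [v [w [uw _ _]]]] := schanuel Einj fg fg1.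
exact: shifted_ext_factor Einj (shifted_ext_middle uw YS QS).
Qed.

(** The connecting map embeds this cokernel in Ext^1(N, X). It is induced by Schanuel's map [v]: if
    [v \o h] lifts to [l : N -> E], the pair of [h] and [l] is killed by [w], so it comes from a map
    [N -> Y] that lifts [h]. *)
Lemma shifted_ext_coker X Y Z (f : {linear X -> Y}) (g : {linear Y -> Z}) :
  short_exact f g -> shifted_ext 0 X -> S (Coker (hom_map N g)).
Proof.
move=> fg [E [Q [f1 [g1 [Einj fg1]]]]].
have [u [v [w [[u_inj uw _] uE wE]]]] := schanuel Einj fg fg1.
have [_ huw] := hom_map_exact N u_inj uw.
apply: (serre_coker (p := quot_proj (im (hom_map N g1)) \o hom_map N v)).
move=> h /proj_eq0/imP[l lE].
have /huw[k kE] : hom_map N w (lin_pair h l : {linear N -> (Z * E)%type}) = 0.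
  apply: linear_ext => x; rewrite /= wE /=.
  have := congr1 (fun u : HomM N Q => u x) lE; rewrite /= => ->.
  by rewrite subrr.
exists k; apply: linear_ext => x; rewrite /= -uE.
by have := congr1 (fun u : HomM N (Z * E)%type => (u x).1) kE.
Qed.

(** The cocycle modules of the fixed resolution are the successive cosyzygies of [X], and they
    supply the embeddings that [shifted_ext] asks for. *)
Lemma shifted_ext_Ext i X : S (Ext i.+1 N X) -> shifted_ext i X.
Proof.
rewrite /Ext /rderived; set E := injres X => SE.
have dZ k (x : E k) : cdiff E k x \in cocycles E k.+1.
  by apply/kerP; exact: cdiffK.
pose d k := sub_corestr (dZ k).
have d_surj k z : exists x, d k x = z.
  by case: z => z zZ; have /kerP/ires_exact[x xz] := zZ; exists x; exact: val_inj.
have d0 k x : d k x = 0 <-> cdiff E k x = 0.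
  by split=> [/(congr1 val)//|dx]; exact: val_inj.
(* Here [k] counts the steps made along the resolution and [j] those left; the conclusion has the
   shape of the last clause of [shifted_extE]. *)
suff claim j k : (j + k)%N = i ->
    if j is j'.+1 then shifted_ext j' (submodule (cocycles E k.+1))
    else S (Coker (hom_map N (d k))).
  have SE0 := claim i 0%N (addn0 i).
  rewrite shifted_extE; exists (E 0), (submodule (cocycles E 1)), (ires_aug E), (d 0%N).
  split=> //; first exact: ires_injective.
  split=> //; first exact: ires_aug_inj.
  by move=> x; rewrite d0; exact: ires_exact0.
elim: j k => [|j IH] k jk.
  move: SE; rewrite -jk add0n.
  pose HE := fcomplex (HomF N) E.
  have hZ (h : HomM N (submodule (cocycles E k.+1))) :
      hom_map N (sub_incl (cocycles E k.+1)) h \in cocycles HE k.+1.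
    by apply/kerP; apply: linear_ext => x; exact: (kerP _ _ (smvalP (h x))).
  (* Maps from [N] to the cocycles of [E] are cocycles of Hom(N, E), so the cokernel embeds in its
     cohomology. *)
  apply: (serre_coker (p := quot_proj (coh_denom HE k.+1) \o sub_corestr hZ)).
  move=> h /proj_eq0/presubP/imP[l lE]; exists l; apply: linear_ext => x.
  by apply: val_inj; exact: (congr1 (fun u : HomM N (E k.+1) => u x) lE).
rewrite /= shifted_extE; exists (E k.+1), (submodule (cocycles E k.+2)),
  (sub_incl (cocycles E k.+1)), (d k.+1).
split; [exact: ires_injective| |by apply: IH; rewrite addnS].
split=> //; first exact: val_inj.
move=> x; rewrite d0; split=> [dx|[[y /kerP dy] <-]//].
have xZ : x \in cocycles E k.+1 by apply/kerP.
by exists (SubModule xZ).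
Qed.

(** * Cocycles, coboundaries and the edge map of a complex of injectives *)

Section Complex.
Variable C : complex R.
Hypothesis C_inj : forall n, injective_module (C n).

Fact cdiff_boundary n x : cdiff C n x \in cocycles C n.+1.
Proof. by apply/kerP; exact: cdiffK. Qed.

Fact cdiff_coboundary n x :
  sub_corestr (@cdiff_boundary n) x \in coh_denom C n.+1.
Proof. by apply/presubP/imP; exists x. Qed.

(** The coboundaries are taken inside the module of cocycles, so that the same module also occurs in
    0 -> B -> Z -> H -> 0. *)
Lemma short_exact_coboundaries n :
  short_exact (sub_incl (cocycles C n)) (sub_corestr (@cdiff_coboundary n)).
Proof.
split; [exact: val_inj| |].
  move=> x; split=> [/(congr1 (fun z => val (val z))) /= dx|[[y yZ] <-]].
    have xZ : x \in cocycles C n by apply/kerP.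
    by exists (SubModule xZ).
  by do 2 apply: val_inj; exact: (kerP _ _ yZ).
move=> [z zB]; have /presubP/imP[x xE] := zB; exists x.
by do 2 apply: val_inj.
Qed.

Lemma shifted_ext_coboundaries0 i : shifted_ext i (submodule (coh_denom C 0)).
Proof.
apply/shifted_ext_injective/injective_module0 => -[[x xZ] xB].
have /presubP/sub0P x0 := xB.
by do 2 apply: val_inj.
Qed.

Lemma shifted_ext_coboundariesS i n :
  shifted_ext i.+1 (submodule (cocycles C n)) ->
  shifted_ext i (submodule (coh_denom C n.+1)).
Proof.
move=> ZS; apply: shifted_ext_connecting (short_exact_coboundaries n) ZS _.
exact: shifted_ext_injective.
Qed.

(** Induction on [n]: Z^n is an extension of H^n by B^n, and B^n is the quotient of an injective by
    Z^(n-1). Each step down the complex raises the Ext degree by one, which keeps [i + n]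
    constant. *)
Lemma shifted_ext_cocycles i n :
  (forall j, (j <= n)%N -> shifted_ext (i + n - j) (cohomology C j)) ->
  shifted_ext i (submodule (cocycles C n)).
Proof.
elim: n i => [|n IH] i HS.
all: apply: shifted_ext_middle (short_exact_quot (coh_denom C _)) _ _.
- exact: shifted_ext_coboundaries0.
- by have := HS 0%N (leqnn 0); rewrite addn0 subn0.
- apply: shifted_ext_coboundariesS; apply: IH => j jn.
  by rewrite addSnnS; apply: HS; exact: leqW.
- by have := HS _ (leqnn n.+1); rewrite addnK.
Qed.

Lemma edgeE n f x : edge N C n (quot_proj _ f) x =
  quot_proj (coh_denom C n) (sub_corestr (edge_cocycle f) x).
Proof. exact: (congr1 (fun u : HomM N _ => u x) (quot_liftE _ f)). Qed.

(** There are no nonzero coboundaries in degree 0, so the edge map is injective. *)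
Lemma serre_Ker_edge0 : S (Ker (edge N C 0)).
Proof.
apply: (serre0 S_serre) => -[y yK]; apply: val_inj.
have [f fE] := proj_surj y; rewrite /= -fE.
apply/proj_eq0/presubP/sub0P; apply: linear_ext => x.
have := congr1 (fun u : HomM N _ => u x) (kerP _ _ yK).
by rewrite -fE edgeE => /proj_eq0/presubP/sub0P.
Qed.

(** A class in the kernel is represented by a map from [N] to the coboundaries, and it vanishes when
    this map lifts to [C n]. The kernel is thus a quotient of the cokernel of Hom(N, C^n) -> Hom(N,
    B^(n+1)). *)
Lemma serre_Ker_edgeS n :
  shifted_ext 0 (submodule (cocycles C n)) -> S (Ker (edge N C n.+1)).
Proof.
move=> /(shifted_ext_coker (short_exact_coboundaries n)).
pose HC := fcomplex (HomF N) C.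
pose B := coh_denom C n.+1.
pose i : {linear submodule B -> C n.+1} := sub_incl _ \o sub_incl B.
have hZ (h : HomM N (submodule B)) : hom_map N i h \in cocycles HC n.+1.
  by apply/kerP; apply: linear_ext => x; exact: (kerP _ _ (smvalP (val (h x)))).
pose q := quot_proj (coh_denom HC n.+1) \o sub_corestr hZ.
have qK h : q h \in ker (edge N C n.+1).
  apply/kerP; apply: linear_ext => x; rewrite edgeE; apply/proj_eq0.
  by rewrite (_ : sub_corestr _ x = val (h x)); [exact: smvalP|exact: val_inj].
apply: (serre_subquotient (p := quot_proj (im _)) (q := sub_corestr qK)).
  case=> y yK; have [f fE] := proj_surj y.
  have fB x : sub_corestr (edge_cocycle f) x \in B.
    have := congr1 (fun u : HomM N _ => u x) (kerP _ _ yK).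
    by rewrite -fE edgeE => /proj_eq0.
  exists (sub_corestr fB); apply: val_inj; rewrite /= -fE.
  by congr (quot_proj _ _); apply: val_inj; exact: linear_ext.
move=> h /proj_eq0/imP[l <-]; apply: val_inj.
by apply/proj_eq0/presubP/imP; exists l; exact: linear_ext.
Qed.

(** A map from [N] to the cohomology that lifts to the cocycles is the edge of the class of its
    lift. *)
Lemma serre_Coker_edge n :
  shifted_ext 0 (submodule (coh_denom C n)) -> S (Coker (edge N C n)).
Proof.
move=> /(shifted_ext_coker (short_exact_quot (coh_denom C n))).
apply: (serre_coker (p := quot_proj (im _))) => h /proj_eq0/imP[l <-].
pose f := hom_map N (sub_incl (cocycles C n)) l.
have fZ : f \in cocycles (fcomplex (HomF N) C) n.
  by apply/kerP; apply: linear_ext => x; exact: (kerP _ _ (smvalP (l x))).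
exists (quot_proj _ (SubModule fZ)); apply: linear_ext => x; rewrite edgeE.
by congr (quot_proj _ _); exact: val_inj.
Qed.

End Complex.
End ShiftedExt.
End SerreSubcategory.

(** * Cohomology under isomorphisms of complexes, and the conclusion for [psi] *)

Section CohomologyIso.
Variables (R : comPzRingType) (C D : complex R) (f : chain_map C D).
Hypotheses (f_inj : forall n, injective (f n)).
Hypotheses (f_surj : forall n y, exists x, f n x = y).

Lemma coh_map_inj n : injective (coh_map f n).
Proof.
move=> x y /eqP; rewrite -subr_eq0 -linearB => /eqP.
have [z zE] := proj_surj (x - y); rewrite -zE quot_liftE.
move=> /proj_eq0/presubP zB; apply/eqP; rewrite -subr_eq0 -zE; apply/eqP.
apply/proj_eq0/presubP.
case: n {x y zE} z zB => [|n] z;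
  first by move=> /sub0P; rewrite -(linear0 (f 0%N)) => /f_inj/sub0P.
move=> /imP[w]; have [v <-] := f_surj w.
by rewrite -cmap_diff => /f_inj vz; apply/imP; exists v.
Qed.

Lemma coh_map_surj n y : exists x, coh_map f n x = y.
Proof.
have [[z zZ] <-] := proj_surj y; have [x xz] := f_surj z.
have xZ : x \in cocycles C n.
  by apply/kerP/f_inj; rewrite cmap_diff xz (kerP _ _ zZ) linear0.
exists (quot_proj _ (SubModule xZ)); rewrite quot_liftE.
by congr (quot_proj _ _); exact: val_inj.
Qed.

End CohomologyIso.

Lemma hom_ciso_inj (R : comPzRingType) (a : ideal R) (G : left_exact_functor R)
    (theta : colon_iso a G) X : injective (hom_ciso theta X).
Proof.
apply: inj_comp (can_inj (@colon_homK _ a (G X))) _.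
exact: inj_comp (bij_inj (ciso_bij theta X)) (can_inj (@hom_colonK _ a X)).
Qed.

Lemma hom_ciso_surj (R : comPzRingType) (a : ideal R) (G : left_exact_functor R)
    (theta : colon_iso a G) X y : exists x, hom_ciso theta X x = y.
Proof.
have [th thK Kth] := ciso_bij theta X.
exists (colon_hom a X (th (hom_colon a (G X) y))).
apply: etrans (hom_colonK y); congr (colon_hom _ _ _).
exact: etrans (congr1 (theta X) (colon_homK _)) (Kth _).
Qed.

Theorem proposition2p1 (R : comPzRingType) (R_noeth : noetherian R)
    (I J : ideal R) (t : nat) (M : lmodType R)
    (S : lmodType R -> Prop) (S_serre : serre S)
    (a : ideal R) (a_W : Wtilde I J a)
    (G : left_exact_functor R) (theta : colon_iso a G)
    (G_inj : forall E : lmodType R,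
       injective_module E -> injective_module (G E)) :
  [/\ (forall j, (j < t)%N ->
         S (Ext (t - j)%N (cyclic_module a) (rderived G j M))) ->
      S (Ker (psi theta t M)),
      (forall j, (j < t)%N ->
         S (Ext (t + 1 - j)%N (cyclic_module a) (rderived G j M))) ->
      S (Coker (psi theta t M))
    & (forall n, n = t \/ n = (t + 1)%N -> forall j, (j < t)%N ->
         S (Ext (n - j)%N (cyclic_module a) (rderived G j M))) ->
      [/\ S (Ker (psi theta t M)), S (Coker (psi theta t M))
        & S (Ext t (cyclic_module a) M) <->
          S (HomM (cyclic_module a) (rderived G t M))]].
Proof.
set N := cyclic_module a; pose C := fcomplex G (injres M).
have C_inj n : injective_module (C n) by exact/G_inj/ires_injective.
pose c := psi_chain theta (injres M).
have c_inj n : injective (c n) by exact: hom_ciso_inj.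
have c_surj n y : exists x, c n x = y by exact: hom_ciso_surj.
have KerS : (forall j, (j < t)%N -> S (Ext (t - j) N (rderived G j M))) ->
    S (Ker (psi theta t M)).
  (* The first factor of [psi] is an isomorphism on cohomology, so only the edge map matters. *)
  move=> HS; suff: S (Ker (edge N C t)).
    have cK (x : Ker (psi theta t M)) :
        (coh_map c t \o sub_incl (ker (psi theta t M))) x \in ker (edge N C t).
      by apply/kerP; exact: (kerP _ _ (smvalP x)).
    apply: (serre_sub S_serre (f := sub_corestr cK)) => x y.
    by move=> /(congr1 val)/(coh_map_inj c_inj c_surj)/val_inj.
  case: t HS => [|s] HS; first exact: serre_Ker_edge0.
  apply: serre_Ker_edgeS => //; apply: shifted_ext_cocycles => // j js.
  apply: shifted_ext_Ext => //; rewrite add0n -subSn//; exact: HS.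
have CokerS : (forall j, (j < t)%N -> S (Ext (t + 1 - j) N (rderived G j M))) ->
    S (Coker (psi theta t M)).
  move=> HS; suff: S (Coker (edge N C t)).
    apply: (serre_coker S_serre (p := quot_proj (im (edge N C t)))).
    move=> h /proj_eq0/imP[x <-].
    by have [y <-] := coh_map_surj c_inj c_surj x; exists y.
  apply: serre_Coker_edge => //.
  (* In degree 0 the coboundaries vanish. For [t = s.+1], the coboundaries in degree [t] are one
     shift above the cocycles in degree [s], which accounts for [t + 1] in the hypothesis. *)
  case: t HS {KerS} => [|s] HS; first exact: shifted_ext_coboundaries0.
  apply: shifted_ext_coboundariesS => //.
  apply: shifted_ext_cocycles => // j js.
  apply: shifted_ext_Ext => //; rewrite -subSn ?leqW// -[(1 + s).+1]/(s.+2).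
  by rewrite -[s.+2]addn1; exact: HS.
split=> // HS.
have KS := KerS (HS t (or_introl erefl)).
have QS := CokerS (HS _ (or_intror erefl)).
(* Forwards, Hom lies between Ext and the cokernel of [psi]; backwards, Ext lies between the kernel
   of [psi] and Hom. *)
split=> //; split=> [ES|FS].
  apply: (serre_middle S_serre (f := psi theta t M) (p := idfun)
    (g := quot_proj (im (psi theta t M)))) ES QS.
    by move=> y; split=> [/proj_eq0/imP|?]; [|apply/proj_eq0/imP].
  by move=> x x0; exact: etrans (congr1 _ x0) (linear0 _).
apply: (serre_middle S_serre (f := sub_incl (ker (psi theta t M))) (p := idfun)
  (g := psi theta t M)) KS FS.
  move=> y; split=> [yK|[[x xK] <-]]; last exact/kerP.
  have yK' : y \in ker (psi theta t M) by apply/kerP.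
  by exists (SubModule yK').
by move=> x x0; exact: etrans (congr1 _ x0) (linear0 _).
Qed.
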